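(* Let $t>0$ and let $X,Y\subset\mathbb{R}^D$ be finite sets such that the weighting vectors of $tX$, $tY$ and $t(X\cup Y)$ all have nonnegative entries. Then $0\le d^t_{Mag}(X,Y)\le 2\,|X\cup Y|$, where $d^t_{Mag}(X,Y)=2\,\mathrm{Mag}(t(X\cup Y))-\mathrm{Mag}(tX)-\mathrm{Mag}(tY)$.
   Context: For a finite set $A\subset\mathbb{R}^D$ and $t>0$, the similarity matrix $\zeta_{tA}(x,y)=\exp(-t\|x-y\|)$ ($x,y\in A$) is invertible; the weighting vector of $tA$ is $\mathbf{w}^t_A=\zeta_{tA}^{-1}\mathbb{1}$ and $\mathrm{Mag}(tA)=\sum_{x\in A}\mathbf{w}^t_A(x)$. $|A|$ is the number of points of $A$. *)

(* Defs.v *)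
From HB Require Import structures.
From mathcomp Require Import all_boot all_order all_algebra.
From mathcomp Require Import finmap.
From mathcomp Require Import reals.
From mathcomp Require Import sequences exp.
Set Implicit Arguments. Unset Strict Implicit. Unset Printing Implicit Defensive.
Import Order.TTheory GRing.Theory Num.Theory.
Local Open Scope ring_scope.
Local Open Scope fset_scope.

Section Magnitude.
Variables (R : realType) (D : nat).

Definition edist (x y : 'rV[R]_D) : R :=
  Num.sqrt (\sum_(i < D) (x 0 i - y 0 i) ^+ 2).

Definition pt (A : {fset 'rV[R]_D}) (i : 'I_#|` A|) : 'rV[R]_D :=
  nth 0 (enum_fset A) i.

Definition zeta (t : R) (A : {fset 'rV[R]_D}) : 'M[R]_#|` A| :=
  \matrix_(i, j) expR (- (t * edist (pt i) (pt j))).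

Definition weighting (t : R) (A : {fset 'rV[R]_D}) : 'cV[R]_#|` A| :=
  invmx (zeta t A) *m const_mx 1.

Definition Mag (t : R) (A : {fset 'rV[R]_D}) : R :=
  \sum_(i < #|` A|) weighting t A i 0.

Definition nonneg_weighting (t : R) (A : {fset 'rV[R]_D}) : Prop :=
  forall i, 0 <= weighting t A i 0.

Definition dMag (t : R) (X Y : {fset 'rV[R]_D}) : R :=
  2 * Mag t (X `|` Y) - Mag t X - Mag t Y.

End Magnitude.

(* Main.v *)
Require Import Defs.
From HB Require Import structures.
From mathcomp Require Import all_boot all_order all_algebra.
From mathcomp Require Import finmap.
From mathcomp Require Import all_classical reals topology normedtype derive realfun.
From mathcomp Require Import sequences exp.
From mathcomp Require Import ring lra.
Set Implicit Arguments. Unset Strict Implicit. Unset Printing Implicit Defensive.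
Import Order.TTheory GRing.Theory Num.Theory.
Import numFieldNormedType.Exports.
Local Open Scope ring_scope.
Local Open Scope classical_set_scope.

(** The matrix [zeta t A] is positive definite, so [Mag t A] is the maximum of
    [2 * sum v - v^T Z v], which is monotone in [A]; hence [0 <= dMag]. If the
    weighting is nonnegative then each weight is at most [(Z w)_i = 1], hence
    [0 <= Mag t A <= |A|] and the upper bound.

    Semidefiniteness: the Gaussian kernel [exp (- a |x-y|^2)] is, up to a
    rank-one factor, a power series with nonnegative coefficients in [<x,y>].
    For a Gaussian kernel [q], [1 - sqrt (1 - q)] is again a power series with
    nonnegative coefficients in [q], hence so is [exp (- c sqrt (1 - q))] up to
    the factor [exp (- c)]. Taking [q = exp (- |x-y|^2 / m)],
    [c = t * sqrt m] and [m] to infinity gives [exp (- t |x-y|)].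

    Definiteness: if [Z v = 0], semidefiniteness on the points of [A] together
    with an arbitrary [y] forces [sum_x v_x exp (- t |x-y|) = 0] for every [y];
    this function of [y] has a cusp at each [x] with [v_x <> 0]. *)

(** * Real analysis: two explicit limits and a cusp *)

Section RealSequences.
Variable R : realType.

Lemma cvg_sumr (I : Type) (r : seq I) (f : I -> nat -> R) (l : I -> R) :
  (forall i, f i n @[n --> \oo] --> l i) ->
  \sum_(i <- r) f i n @[n --> \oo] --> \sum_(i <- r) l i.
Proof.
by move=> fl; apply: cvg_big => [|i _ //]; exact: add_continuous.
Qed.

Lemma cvg_sub_harmonic (a k : R) : a - k * harmonic n @[n --> \oo] --> a.
Proof.
have : a - k * harmonic n @[n --> \oo] --> a - k * 0.
  by apply: cvgB; [exact: cvg_cst|apply: cvgMr; exact: cvg_harmonic].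
by rewrite mulr0 subr0.
Qed.

(* Increases to [1 - sqrt (1 - q)], the smaller root of [p = (q + p ^+ 2) / 2]. *)
Fixpoint sqrt_iter (n : nat) (q : R) : R :=
  if n is m.+1 then (q + sqrt_iter m q ^+ 2) / 2 else 0.

(** With [r = sqrt (1 - q)], one iteration sends the error [d] to [d * (1 - r - d / 2)], at most
    [d * (1 - d / 2)], which forces decay like [2 / n]. At [q = 1] no geometric rate is
    available. *)
Lemma sqrt_iter_bounds (q : R) n : 0 <= q <= 1 ->
  let d := 1 - Num.sqrt (1 - q) - sqrt_iter n q in
  [/\ 0 <= sqrt_iter n q, 0 <= d & n.+1%:R * d <= 2].
Proof.
move=> /andP[q0 q1] /=.
have := sqrtr_ge0 (1 - q); have := @sqr_sqrtr _ (1 - q).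
rewrite subr_ge0 q1 => /(_ isT); set r := Num.sqrt _ => rq r0.
have r1 : r <= 1 by nra.
elim: n => [|n [p0 d0 nd]] /=; first by split; lra.
set p := sqrt_iter n q in p0 d0 nd *.
have dE : 1 - r - (q + p ^+ 2) / 2 = (1 - r - p) * (1 - r + p) / 2.
  by lra.
split; first by apply: divr_ge0 => //; apply: addr_ge0 => //; exact: sqr_ge0.
  by rewrite dE; apply: divr_ge0 => //; apply: mulr_ge0 => //; lra.
rewrite dE -(natr1 n.+1); move: nd d0; set a := n.+1%:R.
set d := 1 - r - p => nd d0.
have d1 : d <= 1 by rewrite /d; lra.
have : d * (1 - r + p) / 2 <= d * (1 - d / 2).
  by rewrite -mulrA ler_wpM2l// /d; lra.
have a0 : 0 <= a by [].
move=> h; apply: (@le_trans _ _ ((a + 1) * (d * (1 - d / 2)))).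
  by rewrite ler_wpM2l //; lra.
(* Twice the bound [(a + 1) * (d * (1 - d / 2))] equals [4 - (2 - a * d) * (2 - d) - d ^+ 2]. *)
have : 0 <= (2 - a * d) * (2 - d) by apply: mulr_ge0; lra.
have := sqr_ge0 d; nra.
Qed.

Lemma cvg_sqrt_iter (q : R) : 0 <= q <= 1 ->
  sqrt_iter n q @[n --> \oo] --> 1 - Num.sqrt (1 - q).
Proof.
move=> q01.
apply: (@squeeze_cvgr _ _ _ _
  (fun n => 1 - Num.sqrt (1 - q) - 2 * harmonic n)
  (fun=> 1 - Num.sqrt (1 - q))).
- near=> n; have [_ d0 nd] := sqrt_iter_bounds n q01.
  apply/andP; split; last lra.
  rewrite lerBlDr -lerBlDl /harmonic/=.
  by rewrite ler_pdivlMr// mulrC.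
- exact: cvg_sub_harmonic.
- exact: cvg_cst.
Unshelve. all: by end_near.
Qed.

(** For [x = s / m], the inequality [1 + y <= expR y] at [y = x] and [y = - x] gives
    [x - x ^+ 2 <= 1 - expR (- x) <= x]. *)
Lemma cvg_difference_quotient_expRN (s : R) : 0 <= s ->
  n.+1%:R * (1 - expR (- (s / n.+1%:R))) @[n --> \oo] --> s.
Proof.
move=> s0.
apply: (@squeeze_cvgr _ _ _ _ (fun n => s - s ^+ 2 * harmonic n) (fun=> s)).
- near=> n; set m : R := n.+1%:R.
  have m0 : 0 < m by [].
  rewrite /harmonic/= -/m; move: m m0 => m m0.
  have x0 : 0 <= s / m by apply: divr_ge0 => //; exact: ltW.
  have h1 := expR_ge1Dx (- (s / m)).
  have h2 := expR_ge1Dx (s / m).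
  have h3 : expR (s / m) * expR (- (s / m)) = 1 by rewrite -expRD subrr expR0.
  have h4 := expR_gt0 (- (s / m)).
  have sE : s = m * (s / m) by rewrite mulrC divfK// gt_eqF.
  set x := s / m in x0 h1 h2 h3 h4 sE *.
  have -> : s ^+ 2 / m = m * x ^+ 2.
    by rewrite /x; field; rewrite gt_eqF.
  have h5 : (1 + x) * expR (- x) <= 1 by rewrite -[leRHS]h3 ler_wpM2r// ltW.
  apply/andP; split; last by rewrite [in leRHS]sE ler_pM2l//; lra.
  rewrite [in leLHS]sE -mulrBr ler_pM2l//; nra.
- exact: cvg_sub_harmonic.
- exact: cvg_cst.
Unshelve. all: by end_near.
Qed.

(** Composing with [ln] would make [- c * |h|] derivable at 0, but its one-sided quotients are [- c]
    and [c]. *)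
Lemma expR_normM_not_derivable (c : R) : 0 < c ->
  ~ derivable (fun h => expR (- (c * `|h|))) (0 : R) 1.
Proof.
move=> c0 dE.
have [l] : exists l : R, h^-1 * (- (c * `|h|)) @[h --> (0 : R)^'] --> l.
  have : derivable (@ln R \o (fun h => expR (- (c * `|h|)))) (0 : R) 1.
    apply/derivable1_diffP/differentiable_comp; first exact/derivable1_diffP.
    apply/derivable1_diffP; apply: ex_derive; apply: is_derive1_ln.
    exact: expR_gt0.
  move=> /cvg_ex[l hl]; exists l; apply: cvg_trans hl.
  apply: near_eq_cvg; near=> h.
  rewrite /= !expRK normr0 mulr0 oppr0 subr0 addr0.
  by rewrite /GRing.scale/= mulr1.
move=> hl.
have hr : l = - c.
  have := cvg_dnbhs_at_right hl.
  move=> /(cvg_lim (@Rhausdorff R)) <-; apply: cvg_lim => //.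
  apply: cvg_near_cst; near=> h.
  have h0 : 0 < h by near: h; exact: nbhs_right_gt.
  by rewrite gtr0_norm//; field; rewrite gt_eqF.
have hL : l = c.
  have := cvg_dnbhs_at_left hl.
  move=> /(cvg_lim (@Rhausdorff R)) <-; apply: cvg_lim => //.
  apply: cvg_near_cst; near=> h.
  have h0 : h < 0 by near: h; exact: nbhs_left_lt.
  by rewrite ltr0_norm//; field; rewrite lt_eqF.
lra.
Unshelve. all: by end_near.
Qed.

End RealSequences.

(** * Positive semidefinite kernels and closure properties of Schur multipliers *)

Section Kernels.
Variables (R : realType) (T : Type).
Implicit Types K B : T -> T -> R.

Definition psd_kernel K := forall (I : finType) (x : I -> T) (v : I -> R),
  0 <= \sum_i \sum_j v i * v j * K (x i) (x j).

(* Every kernel met below is a limit of sums of rank-one kernels; for those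
   this property is immediate, and it is stable under products by design, which
   replaces the Schur product theorem. *)
Definition schur_multiplier K :=
  forall B, psd_kernel B -> psd_kernel (fun x y => K x y * B x y).

Lemma psd_kernel1 : psd_kernel (fun _ _ => 1).
Proof.
move=> I x v.
suff -> : \sum_i \sum_j v i * v j * 1 = (\sum_i v i) ^+ 2 by exact: sqr_ge0.
rewrite expr2 mulr_suml; apply: eq_bigr => i _.
by rewrite mulr_sumr; apply: eq_bigr => j _; rewrite mulr1.
Qed.

Lemma schur_multiplier_psd K : schur_multiplier K -> psd_kernel K.
Proof.
move=> KM I x v; have := KM _ psd_kernel1 I x v.
by under eq_bigr do under eq_bigr do rewrite mulr1.
Qed.

Lemma schur_multiplier_eq K K' :
  (forall x y, K x y = K' x y) -> schur_multiplier K -> schur_multiplier K'.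
Proof.
move=> KK' KM B B0 I x v; have := KM B B0 I x v.
by under eq_bigr do under eq_bigr do rewrite KK'.
Qed.

Lemma schur_multiplier_rank1 (f : T -> R) :
  schur_multiplier (fun x y => f x * f y).
Proof.
(* The two factors [f] are absorbed into the weights. *)
move=> B B0 I x v; have := B0 I x (fun i => v i * f (x i)).
congr (0 <= _); apply: eq_bigr => i _; apply: eq_bigr => j _; ring.
Qed.

Lemma schur_multiplier_cst (c : R) : 0 <= c -> schur_multiplier (fun _ _ => c).
Proof.
move=> c0; apply: schur_multiplier_eq (schur_multiplier_rank1 (fun=> Num.sqrt c)).
by move=> _ _; rewrite -expr2 sqr_sqrtr.
Qed.

Lemma schur_multiplierD K K' : schur_multiplier K -> schur_multiplier K' ->
  schur_multiplier (fun x y => K x y + K' x y).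
Proof.
move=> KM KM' B B0 I x v; have := addr_ge0 (KM B B0 I x v) (KM' B B0 I x v).
rewrite -big_split/=; congr (0 <= _); apply: eq_bigr => i _.
by rewrite -big_split/=; apply: eq_bigr => j _; ring.
Qed.

Lemma schur_multiplierM K K' : schur_multiplier K -> schur_multiplier K' ->
  schur_multiplier (fun x y => K x y * K' x y).
Proof.
move=> KM KM' B B0 I x v; have := KM _ (KM' B B0) I x v.
by congr (0 <= _); apply: eq_bigr => i _; apply: eq_bigr => j _; ring.
Qed.

Lemma schur_multiplier_sum (J : Type) (r : seq J) (K : J -> T -> T -> R) :
  (forall k, schur_multiplier (K k)) ->
  schur_multiplier (fun x y => \sum_(k <- r) K k x y).
Proof.
move=> KM; elim: r => [|k r IH].
  apply: schur_multiplier_eq (schur_multiplier_cst (lexx 0)) => x y.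
  by rewrite big_nil.
apply: schur_multiplier_eq (schur_multiplierD (KM k) IH) => x y.
by rewrite big_cons.
Qed.

Lemma schur_multiplierX K n : schur_multiplier K ->
  schur_multiplier (fun x y => K x y ^+ n).
Proof.
move=> KM; elim: n => [|n IH]; first exact: schur_multiplier_cst.
apply: schur_multiplier_eq (schur_multiplierM KM IH) => x y.
by rewrite exprS.
Qed.

Lemma schur_multiplier_lim (K : nat -> T -> T -> R) L :
  (forall n, schur_multiplier (K n)) ->
  (forall x y, K n x y @[n --> \oo] --> L x y) -> schur_multiplier L.
Proof.
move=> KM KL B B0 I x v.
apply: (@cvgr_to_ge _ \oo _ _
  (fun n => \sum_i \sum_j v i * v j * (K n (x i) (x j) * B (x i) (x j)))).
  apply: cvg_sumr => i; apply: cvg_sumr => j.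
  by apply: cvgMr; apply: cvgMl; exact: KL.
by apply: nearW => n; exact: KM.
Qed.

Lemma schur_multiplier_expR K : schur_multiplier K ->
  schur_multiplier (fun x y => expR (K x y)).
Proof.
move=> KM; apply: (@schur_multiplier_lim (fun n x y => series (exp_coeff (K x y)) n)).
  move=> n; apply: schur_multiplier_sum => k.
  apply: schur_multiplierM; first exact: schur_multiplierX.
  by apply: schur_multiplier_cst; rewrite invr_ge0 ler0n.
by move=> x y; exact: is_cvg_series_exp_coeff.
Qed.

Lemma schur_multiplier_sqrt K : (forall x y, 0 <= K x y <= 1) ->
  schur_multiplier K ->
  schur_multiplier (fun x y => 1 - Num.sqrt (1 - K x y)).
Proof.
move=> K01 KM; apply: (@schur_multiplier_lim (fun n x y => sqrt_iter n (K x y))).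
  elim=> [|n IH] /=.
    exact: (schur_multiplier_cst (lexx 0)).
  apply: schur_multiplierM; last by apply: schur_multiplier_cst; rewrite invr_ge0.
  by apply: schur_multiplierD => //; exact: schur_multiplierX.
by move=> x y; exact: cvg_sqrt_iter.
Qed.

Lemma schur_multiplier_expRN_sqrt K c : 0 <= c ->
  (forall x y, 0 <= K x y <= 1) -> schur_multiplier K ->
  schur_multiplier (fun x y => expR (- (c * Num.sqrt (1 - K x y)))).
Proof.
move=> c0 K01 KM.
have h : schur_multiplier
    (fun x y => expR (- c) * expR (c * (1 - Num.sqrt (1 - K x y)))).
  apply: schur_multiplierM; first by apply: schur_multiplier_cst; exact: expR_ge0.
  apply: schur_multiplier_expR; apply: schur_multiplierM.
    exact: schur_multiplier_cst.
  exact: schur_multiplier_sqrt.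
by apply: schur_multiplier_eq h => x y; rewrite -expRD; congr expR; ring.
Qed.

(* If [exp (- s / m)] is a multiplier for all [m], so is
   [exp (- t * sqrt (m * (1 - exp (- s / m))))]; now let [m] go to infinity. *)
Lemma schur_multiplier_expRN_sqrt_dist (s : T -> T -> R) t :
  0 <= t -> (forall x y, 0 <= s x y) ->
  (forall a, 0 <= a -> schur_multiplier (fun x y => expR (- (a * s x y)))) ->
  schur_multiplier (fun x y => expR (- (t * Num.sqrt (s x y)))).
Proof.
move=> t0 s0 sM.
pose q m x y := expR (- (s x y / m.+1%:R)).
apply: (@schur_multiplier_lim (fun m x y =>
    expR (- (t * Num.sqrt m.+1%:R * Num.sqrt (1 - q m x y))))).
  move=> m; apply: schur_multiplier_expRN_sqrt.
  - by apply: mulr_ge0 => //; exact: sqrtr_ge0.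
  - move=> x y; rewrite /q expR_ge0 -[leRHS]expR0 ler_expR oppr_le0.
    exact: divr_ge0.
  - have := sM m.+1%:R^-1; rewrite invr_ge0 ler0n => /(_ isT).
    by apply: schur_multiplier_eq => x y; rewrite /q mulrC.
move=> x y; apply: continuous_cvg; first exact: continuous_expR.
apply: cvgN.
have : t * Num.sqrt (m.+1%:R * (1 - q m x y)) @[m --> \oo]
    --> t * Num.sqrt (s x y).
  apply: cvgMr; apply: continuous_cvg; first exact: sqrt_continuous.
  exact: cvg_difference_quotient_expRN.
by under eq_fun do rewrite sqrtrM// mulrA.
Qed.

End Kernels.

(** * Semidefiniteness of the Gaussian and exponential kernels *)

Section ExponentialKernel.
Variables (R : realType) (D : nat).
Implicit Types x y : 'rV[R]_D.

Definition sqdist x y : R := \sum_(i < D) (x 0 i - y 0 i) ^+ 2.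

Lemma sqdist_ge0 x y : 0 <= sqdist x y.
Proof. by apply: sumr_ge0 => i _; exact: sqr_ge0. Qed.

(** Expanding [|x-y|^2 = N x + N y - 2 <x,y>] splits off a rank-one factor and leaves the
    exponential of a nonnegative multiple of [<x,y>]. *)
Lemma schur_multiplier_gauss a : 0 <= a ->
  schur_multiplier (fun x y => expR (- (a * sqdist x y))).
Proof.
move=> a0; pose N x := \sum_(i < D) x 0 i ^+ 2.
pose f x := expR (- (a * N x)).
have h : schur_multiplier (fun x y =>
    f x * f y * expR (2 * a * \sum_(i < D) x 0 i * y 0 i)).
  apply: schur_multiplierM; first exact: schur_multiplier_rank1.
  apply: schur_multiplier_expR; apply: schur_multiplierM.
    by apply: schur_multiplier_cst; exact: mulr_ge0.
  apply: schur_multiplier_sum => i.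
  exact: (schur_multiplier_rank1 (fun x => x 0 i)).
apply: schur_multiplier_eq h => x y; rewrite -!expRD; congr expR.
rewrite /sqdist /N !mulr_sumr -!sumrN -!big_split/=.
by apply: eq_bigr => i _; ring.
Qed.

Lemma psd_expRN_edist (t : R) : 0 <= t ->
  psd_kernel (fun x y : 'rV[R]_D => expR (- (t * Defs.edist x y))).
Proof.
move=> t0; apply: schur_multiplier_psd.
apply: (@schur_multiplier_expRN_sqrt_dist _ _ sqdist) => //.
  exact: sqdist_ge0.
exact: schur_multiplier_gauss.
Qed.

End ExponentialKernel.

(* The quadratic form of the enlarged family with weight [s] at [y] is
   [2 * s * g + s ^+ 2], where [g] is the sum to be shown zero. *)
Lemma psd_kernel_potential_eq0 (R : realType) (T : Type) (K : T -> T -> R)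
    (I : finType) (x : I -> T) (v : I -> R) :
  psd_kernel K -> (forall x y, K x y = K y x) -> (forall x, K x x = 1) ->
  \sum_i \sum_j v i * v j * K (x i) (x j) = 0 ->
  forall y, \sum_i v i * K (x i) y = 0.
Proof.
move=> K0 Ksym K1 v0 y; set g := \sum_i _.
(* The choice [s = - g] minimises the form, so semidefiniteness reads [0 <= - g ^+ 2]. *)
have := K0 _ (fun i : I + unit => if i is inl j then x j else y)
  (fun i => if i is inl j then v j else - g).
rewrite big_sumType/=.
under eq_bigr do rewrite big_sumType/= (big_pred1 tt)//.
rewrite big_split/= v0 add0r (big_pred1 tt)//= big_sumType/= (big_pred1 tt)//= K1.
have -> : \sum_i v i * - g * K (x i) y = - g ^+ 2.
  rewrite (eq_bigr (fun i => - g * (v i * K (x i) y))) => [|i _]; last by ring.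
  by rewrite -mulr_sumr -/g expr2 mulNr.
have -> : \sum_i - g * v i * K y (x i) = - g ^+ 2.
  rewrite (eq_bigr (fun i => - g * (v i * K (x i) y))) => [|i _].
    by rewrite -mulr_sumr -/g expr2 mulNr.
  by rewrite Ksym; ring.
move=> h; apply/eqP; rewrite -sqrf_eq0 -/g eq_le sqr_ge0 andbT; lra.
Qed.

(** * Linear independence of the functions [exp (- t |x-y|)] of [y] *)

Section StrictPositivity.
Variables (R : realType) (D : nat).
Implicit Types x y : 'rV[R]_D.

Lemma edistC x y : Defs.edist x y = Defs.edist y x.
Proof.
by congr Num.sqrt; apply: eq_bigr => i _; rewrite -sqrrN opprB.
Qed.

Lemma edistxx x : Defs.edist x x = 0.
Proof.
by rewrite /Defs.edist big1 ?sqrtr0// => i _; rewrite subrr expr0n.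
Qed.

Lemma sqdist_gt0 x y : x != y -> 0 < sqdist x y.
Proof.
move=> xy; rewrite lt_neqAle sqdist_ge0 andbT eq_sym.
apply: contra xy; rewrite psumr_eq0 => [/allP h|i _]; last exact: sqr_ge0.
apply/eqP/rowP => i; apply/eqP; rewrite -subr_eq0 -sqrf_eq0.
exact: h (mem_index_enum i).
Qed.

Lemma edist_ray x u (h : R) :
  Defs.edist x (x + h *: u) = Num.sqrt (sqdist u 0) * `|h|.
Proof.
rewrite mulrC -sqrtr_sqr -sqrtrM ?sqr_ge0//; congr Num.sqrt.
rewrite mulr_sumr; apply: eq_bigr => i _; rewrite !mxE; ring.
Qed.

(** As [x != y], the squared distance is positive at [h = 0], where the square root is then
    differentiable. *)
Lemma derivable_expRN_edist_ray (t : R) x y u : x != y ->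
  derivable (fun h : R => expR (- (t * Defs.edist x (y + h *: u)))) 0 1.
Proof.
move=> xy; pose N (h : R) := sqdist x (y + h *: u).
have dN : derivable N 0 1.
  pose G i : R -> R := fun h => (x 0 i - y 0 i) - u 0 i * h.
  have -> : N = \sum_(i < D) G i ^+ 2.
    apply/funext => h; rewrite fct_sumE; apply: eq_bigr => i _.
    by rewrite !mxE opprD addrA [h * _]mulrC fctE.
  apply: derivable_sum => i; apply: derivableX.
  apply: derivableB; first exact: derivable_cst.
  by apply: (@derivableZ _ _ _ id); exact: derivable_id.
have dS : derivable (Num.sqrt \o N) 0 1.
  apply/derivable1_diffP/differentiable_comp; first exact/derivable1_diffP.
  apply/derivable1_diffP; apply: ex_derive; apply: is_derive1_sqrt.
  by rewrite /N scale0r addr0 sqdist_gt0.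
have dE : derivable (fun h : R => - (t * (Num.sqrt \o N) h)) 0 1.
  by apply: derivableN; apply: derivableM => //; exact: derivable_cst.
apply/derivable1_diffP; apply: (@differentiable_comp _ _ _ _ _ (@expR R)).
  exact/derivable1_diffP/dE.
by apply/derivable1_diffP; exact: derivable_expR.
Qed.

(* Along a line through [x i] the [i]-th summand has a cusp at [x i], whereas
   the other summands are differentiable there. *)
Lemma expRN_edist_free n (x : 'I_n -> 'rV[R]_D) (v : 'I_n -> R) (t : R) :
  0 < t -> injective x ->
  (forall y, \sum_i v i * expR (- (t * Defs.edist (x i) y)) = 0) ->
  forall i, v i = 0.
Proof.
move=> t0 xinj v0 i.
(* A second point supplies a nonzero direction [u]; if there is none, the sum at [x i] is just
   [v i]. *)
have [/existsP[k ki]|/existsPn noj] := boolP [exists j, j != i]; last first.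
  have := v0 (x i); rewrite (bigD1 i)//= big1 => [|j ji]; last first.
    by have := noj j; rewrite ji.
  by rewrite edistxx mulr0 oppr0 expR0 mulr1 addr0.
pose u := x k - x i.
have u0 : u != 0 by rewrite subr_eq0; apply: contra ki => /eqP/xinj ->.
apply/eqP/negP => /negP vi0.
pose c := t * Num.sqrt (sqdist u 0).
have c0 : 0 < c by rewrite mulr_gt0// sqrtr_gt0 sqdist_gt0.
apply: (expR_normM_not_derivable c0).
(* Setting [F i] to zero removes the cusp term while keeping a sum over all indices. *)
pose F j (h : R) : R := if j == i then 0 else
  v j * expR (- (t * Defs.edist (x j) (x i + h *: u))).
have -> : (fun h : R => expR (- (c * `|h|))) =
    (fun h => - (v i)^-1 * (\sum_j F j) h).
  apply/funext => h; rewrite fct_sumE.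
  have := v0 (x i + h *: u); rewrite (bigD1 i)//= edist_ray mulrA -/c.
  move=> /addr0_eq h0; rewrite (bigD1 i)//= {1}/F eqxx add0r.
  rewrite (eq_bigr (fun j => v j *
    expR (- (t * Defs.edist (x j) (x i + h *: u))))); last first.
    by move=> j /negbTE ji; rewrite /F ji.
  by rewrite -h0; field.
apply: derivableM; first exact: derivable_cst.
apply: derivable_sum => j; rewrite /F.
have [_|ji] := eqVneq j i; first exact: derivable_cst.
apply: derivableM; first exact: derivable_cst.
by apply: derivable_expRN_edist_ray; apply: contra ji => /eqP/xinj ->.
Qed.

End StrictPositivity.

(** * Weightings, monotonicity of magnitude and its bounds *)

Section MagnitudeBounds.
Variables (R : realType) (D : nat) (t : R).
Hypothesis t_gt0 : 0 < t.
Implicit Types A B : {fset 'rV[R]_D}.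

Definition exp_kernel (x y : 'rV[R]_D) : R := expR (- (t * Defs.edist x y)).

Local Notation K := exp_kernel.

Let psdK : psd_kernel K.
Proof. exact/psd_expRN_edist/ltW. Qed.

Let KC x y : K x y = K y x.
Proof. by rewrite /exp_kernel edistC. Qed.

Let Kxx x : K x x = 1.
Proof. by rewrite /exp_kernel edistxx mulr0 oppr0 expR0. Qed.

Lemma pt_inj A : injective (@pt R D A).
Proof.
move=> i j /eqP; rewrite /pt nth_uniq ?fset_uniq// => /eqP.
exact: val_inj.
Qed.

Lemma zeta_unitmx A : zeta t A \in unitmx.
Proof.
rewrite -row_free_unit -kermx_eq0; apply/negP => /negP /rowV0Pn[v].
move=> /sub_kermxP vZ /negP[]; apply/eqP/rowP => i; rewrite mxE.
have vK j : \sum_i v 0 i * K (pt i) (@pt _ _ A j) = 0.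
  have := congr1 (fun w : 'rV_ _ => w 0 j) vZ; rewrite !mxE => vZj.
  rewrite -[RHS]vZj.
  by apply: eq_bigr => k _; rewrite mxE.
move: i; apply: (expRN_edist_free t_gt0 (@pt_inj A)).
apply: (psd_kernel_potential_eq0 psdK KC Kxx).
rewrite exchange_big big1//= => j _.
rewrite (eq_bigr (fun i => v 0 j * (v 0 i * K (pt i) (pt j)))).
  by rewrite -mulr_sumr vK mulr0.
by move=> i _; ring.
Qed.

Lemma zeta_weighting A (i : 'I_#|` A|%fset) :
  \sum_j K (pt i) (pt j) * weighting t A j 0 = 1.
Proof.
have := congr1 (fun w : 'cV_ _ => w i 0) (mulKVmx (zeta_unitmx A) (const_mx 1)).
rewrite -/(weighting t A) [RHS]mxE mxE => Zw.
rewrite -[RHS]Zw.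
by apply: eq_bigr => j _; rewrite [zeta _ _ _ _]mxE.
Qed.

(** Stated by membership rather than by index, so that the weighting of a larger set can be
    evaluated at points of a subset. *)
Lemma potential_weighting A x : x \in A ->
  \sum_j K x (pt j) * weighting t A j 0 = 1.
Proof.
move=> xA; have iA : (index x (enum_fset A) < #|` A|%fset)%N by rewrite index_mem.
by rewrite -(zeta_weighting (Ordinal iA)) /pt nth_index.
Qed.

(* Positivity of the quadratic form at the signed measure [w_A - w_B]. *)
Lemma Mag_le A B : (A `<=` B)%fset -> Mag t A <= Mag t B.
Proof.
move=> /fsubsetP AB.
have := psdK (fun i : 'I_#|` A|%fset + 'I_#|` B|%fset =>
    match i with inl j => pt j | inr j => pt j end)
  (fun i => match i with inl j => weighting t A j 0
                       | inr j => - weighting t B j 0 end).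
have ptA (i : 'I_#|` A|%fset) : pt i \in A by exact: mem_nth.
have ptB (i : 'I_#|` B|%fset) : pt i \in B by exact: mem_nth.
rewrite big_sumType/=.
(* Rows at points of [A] cancel, since both weightings have potential 1 there. *)
rewrite [X in _ <= X + _]big1 => [|i _]; last first.
  rewrite big_sumType/=.
  rewrite (eq_bigr (fun j => weighting t A i 0 *
    (K (pt i) (pt j) * weighting t A j 0))) => [|j _]; last by ring.
  rewrite -mulr_sumr potential_weighting//.
  rewrite (eq_bigr (fun j => - weighting t A i 0 *
    (K (pt i) (pt j) * weighting t B j 0))) => [|j _]; last by ring.
  by rewrite -mulr_sumr potential_weighting ?AB// mulNr subrr.
rewrite add0r.
under eq_bigr do rewrite big_sumType/=.
(* Summing the mixed block over [B] first lets the potential of [w_B] at points of [A] turn it into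
   [- Mag t A]; the last block gives [Mag t B]. *)
rewrite big_split/= exchange_big/=.
rewrite (eq_bigr (fun i => - weighting t A i 0)) => [|i _]; last first.
  rewrite (eq_bigr (fun j => - weighting t A i 0 *
    (K (pt i) (pt j) * weighting t B j 0))) => [|j _]; last by rewrite KC; ring.
  by rewrite -mulr_sumr potential_weighting ?AB// mulr1.
rewrite (eq_bigr (fun i => weighting t B i 0)) => [|i _]; last first.
  rewrite (eq_bigr (fun j => weighting t B i 0 *
    (K (pt i) (pt j) * weighting t B j 0))) => [|j _]; last by ring.
  by rewrite -mulr_sumr potential_weighting// mulr1.
by rewrite sumrN addrC subr_ge0.
Qed.

Lemma Mag_ge0 A : nonneg_weighting t A -> 0 <= Mag t A.
Proof. by move=> w0; apply: sumr_ge0 => i _. Qed.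

Lemma Mag_le_card A : nonneg_weighting t A -> Mag t A <= (#|` A|%fset)%:R.
Proof.
move=> w0; rewrite -[X in _ <= X%:R]card_ord -sumr_const; apply: ler_sum => i _.
rewrite -(zeta_weighting i) (bigD1 i)//= Kxx mul1r lerDl; apply: sumr_ge0 => j _.
by apply: mulr_ge0 => //; exact: expR_ge0.
Qed.

End MagnitudeBounds.

Local Close Scope classical_set_scope.
Local Open Scope fset_scope.

Theorem theorem5p5 (R : realType) (D : nat) (t : R) (X Y : {fset 'rV[R]_D}) :
  0 < t ->
  nonneg_weighting t X -> nonneg_weighting t Y -> nonneg_weighting t (X `|` Y) ->
  0 <= dMag t X Y /\ dMag t X Y <= 2 * (#|` X `|` Y|)%:R.
Proof.
move=> t0 wX wY wXY; rewrite /dMag.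
have hX := Mag_le t0 (fsubsetUl X Y); have hY := Mag_le t0 (fsubsetUr X Y).
have hXY := Mag_le_card t0 wXY.
have mX := Mag_ge0 wX; have mY := Mag_ge0 wY.
by split; lra.
Qed.
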